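(* Let $p\ge5$ be prime, $i\in\mathbb{N}_0$, and let $\gamma=\sum_{a=2}^{(p-1)/2}c_a\vartheta_a$ and $\gamma'=\sum_{a=2}^{(p-1)/2}c'_a\vartheta_a$ (with $c_a,c'_a\in K$) have restrictions to $\mathfrak{p}^i\wedge\mathfrak{p}^i$ lying in $\hat H_i$. Let $m$ be such that $L_{i,m}(\gamma)$ and $L_{i,m}(\gamma')$ are defined and have nilpotency class at most $p-1$. If there exist $u\in\mathcal{U}$ and $\sigma\in\mathrm{Gal}(K/\mathbb{Q}_p)$ with $$\sigma(c'_a)\equiv\rho_a(u)\,c_a \pmod{\mathfrak{p}^m}\quad\text{for all } 2\le a\le (p-1)/2,$$ then $S_{i,m}(\gamma)\cong S_{i,m}(\gamma')$.
   Context: Let $\theta$ be a primitive $p$-th root of unity, $K=\mathbb{Q}_p(\theta)$, $\mathcal{O}$ its ring of integers, $\mathcal{U}$ the unit group of $\mathcal{O}$, $\mathfrak{p}$ its maximal ideal; $\mathfrak{p}^j$ is the unique ideal of index $p^j$, $\mathfrak{p}^\infty=\{0\}$. $\sigma_j$ denotes the Galois automorphism $\theta\mapsto\theta^j$. For $a\in\{2,\dots,(p-1)/2\}$, $\vartheta_a:K\wedge K\to K$, $\vartheta_a(x\wedge y)=\sigma_a(x)\sigma_{1-a}(y)-\sigma_{1-a}(x)\sigma_a(y)$, and $\rho_a(u)=u^{-1}\sigma_a(u)\sigma_{1-a}(u)$ for $u\in\mathcal{U}$. $P=\langle\theta\rangle$ acts by multiplication on ideals and diagonally on exterior squares (over $\mathbb{Z}_p$);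 $\hat{H}_i=\{\gamma\in\mathrm{Hom}_P(\mathfrak{p}^i\wedge\mathfrak{p}^i,\mathfrak{p}^{2i+1}) \mid \gamma \text{ surjective}\}$. $J_i(\gamma)$ is the ideal generated by all $\gamma(\gamma(x\wedge y)\wedge z)+\gamma(\gamma(y\wedge z)\wedge x)+\gamma(\gamma(z\wedge x)\wedge y)$, $x,y,z\in\mathfrak{p}^i$, and $J_i(\gamma)=\mathfrak{p}^\ell$. For $i\le m\le\ell$, $L_{i,m}(\gamma)$ is $\mathfrak{p}^i/\mathfrak{p}^m$ with bracket $[a+\mathfrak{p}^m,b+\mathfrak{p}^m]=\gamma(a\wedge b)+\mathfrak{p}^m$. If it has class at most $p-1$, the Lazard correspondence gives a $p$-group $\mathbb{G}(L_{i,m}(\gamma))$ on the same set, on which multiplication by $\theta$ is an automorphism, and $S_{i,m}(\gamma)=\mathbb{G}(L_{i,m}(\gamma))\rtimes P$. *)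

(* Defs.v *)
From mathcomp Require Import all_boot all_algebra.
From Stdlib Require Import ClassicalEpsilon.
Set Implicit Arguments.
Unset Strict Implicit.
Unset Printing Implicit Defensive.
Import GRing.Theory.
Local Open Scope ring_scope.

(* An element of Z[theta] (or R[theta], R a coefficient ring) is written in the
   basis 1, theta, ..., theta^(p-2); theta^(p-1) = -(1 + ... + theta^(p-2)). *)

(* coordinates of theta^s, for s < p *)
Definition ebasis (R : comNzRingType) (p s : nat) : 'rV[R]_(p.-1) :=
  \row_(t < p.-1) (if s == val t then 1 else if s == p.-1 then -1 else 0).

(* multiplication in R[theta] = R[x]/(Phi_p) *)
Definition cmul (R : comNzRingType) (p : nat) (x y : 'rV[R]_(p.-1)) : 'rV[R]_(p.-1) :=
  \sum_(i < p.-1) \sum_(j < p.-1) (x 0 i * y 0 j) *: ebasis R p ((i + j) %% p).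

Definition csig (R : comNzRingType) (p j : nat) (x : 'rV[R]_(p.-1)) : 'rV[R]_(p.-1) :=
  \sum_(t < p.-1) x 0 t *: ebasis R p ((j * t) %% p).

Arguments ebasis R p s : clear implicits.
Arguments cmul {R} p x y.
Arguments csig {R} p j x.

(* ---------- O = Z_p[theta] as the inverse limit of the levels ---------- *)
Definition PO (p : nat) := forall n : nat, 'rV['Z_(p ^ n.+1)]_(p.-1).

Definition isO (p : nat) (x : PO p) : Prop :=
  forall n : nat,
    map_mx (fun z : 'Z_(p ^ n.+2) => (inZp (nat_of_ord z) : 'Z_(p ^ n.+1))) (x n.+1)
    = x n.

Section Ops.
Variable p : nat.
Definition Ozero : PO p := fun n => 0.
Definition Oone : PO p := fun n => ebasis _ p 0.
Definition Otheta : PO p := fun n => ebasis _ p 1.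
Definition Oadd (x y : PO p) : PO p := fun n => x n + y n.
Definition Oopp (x : PO p) : PO p := fun n => - x n.
Definition Osub (x y : PO p) : PO p := Oadd x (Oopp y).
Definition Omul (x y : PO p) : PO p := fun n => cmul p (x n) (y n).
Definition Opow (x : PO p) (k : nat) : PO p := iter k (Omul x) Oone.
Definition Onat (k : nat) (x : PO p) : PO p := fun n => x n *+ k.
Definition Oint (z : int) (x : PO p) : PO p := fun n => x n *~ z.
Definition Osig (j : nat) (x : PO p) : PO p := fun n => csig p j (x n).
Definition Osum (s : seq (PO p)) : PO p := foldr Oadd Ozero s.
Definition Opi : PO p := Osub Otheta Oone.

Definition Pin (j : nat) (x : PO p) : Prop :=
  isO x /\ exists y : PO p, isO y /\ x = Omul (Opow Opi j) y.

(* ---------- K = O[1/p]: (k, d) represents d / p^k ---------- *)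
Definition Kelt := (nat * PO p)%type.
Definition isK (c : Kelt) : Prop := isO c.2.
Definition KofO (x : PO p) : Kelt := (0%N, x).
Definition Kadd (c c' : Kelt) : Kelt :=
  ((c.1 + c'.1)%N, Oadd (Onat (p ^ c'.1) c.2) (Onat (p ^ c.1) c'.2)).
Definition Kopp (c : Kelt) : Kelt := (c.1, Oopp c.2).
Definition Ksub (c c' : Kelt) : Kelt := Kadd c (Kopp c').
Definition Kmul (c c' : Kelt) : Kelt := ((c.1 + c'.1)%N, Omul c.2 c'.2).
Definition Keq (c c' : Kelt) : Prop := Onat (p ^ c'.1) c.2 = Onat (p ^ c.1) c'.2.
(* c lies in the fractional ideal p^j of K  (p = unit * pi^(p-1)) *)
Definition Kin (j : nat) (c : Kelt) : Prop := Pin (j + c.1 * p.-1) c.2.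
Definition Ksig (j : nat) (c : Kelt) : Kelt := (c.1, Osig j c.2).
Definition KtoO (c : Kelt) : PO p :=
  epsilon (inhabits Ozero) (fun z => isO z /\ Onat (p ^ c.1) z = c.2).

(* sigma_{1-a} is sigma_{p+1-a} *)
Definition vartheta (a : nat) (x y : PO p) : PO p :=
  Osub (Omul (Osig a x) (Osig (p.+1 - a) y)) (Omul (Osig (p.+1 - a) x) (Osig a y)).

Definition rho (a : nat) (u uinv : PO p) : PO p :=
  Omul uinv (Omul (Osig a u) (Osig (p.+1 - a) u)).

Definition arange : seq nat := iota 2 ((p.-1)./2 - 1).

Definition gammaK (c : nat -> Kelt) (x y : PO p) : Kelt :=
  foldr (fun a acc => Kadd (Kmul (c a) (KofO (vartheta a x y))) acc) (KofO Ozero) arange.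

(* gamma(x /\ y) as an element of O (meaningful when it lies in O) *)
Definition gamO (c : nat -> Kelt) (x y : PO p) : PO p := KtoO (gammaK c x y).

(* restriction of gamma to p^i /\ p^i lies in \hat H_i : it maps into
   p^(2i+1) and its image (the span of the gamma(x /\ y)) is all of p^(2i+1).
   (P-equivariance and Z_p-linearity hold automatically for such gamma.) *)
Definition inHhat (i : nat) (c : nat -> Kelt) : Prop :=
  (forall x y, Pin i x -> Pin i y -> Kin (2 * i + 1) (gammaK c x y)) /\
  (forall z, Pin (2 * i + 1) z ->
     exists s : seq (PO p * PO p),
       (forall q, List.In q s -> Pin i q.1 /\ Pin i q.2) /\
       Keq (foldr (fun q acc => Kadd (gammaK c q.1 q.2) acc) (KofO Ozero) s)
           (KofO z)).

Definition jacobi (c : nat -> Kelt) (x y z : PO p) : PO p :=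
  Oadd (gamO c (gamO c x y) z) (Oadd (gamO c (gamO c y z) x) (gamO c (gamO c z x) y)).

(* L_{i,m}(gamma) is defined: i <= m <= l where J_i(gamma) = p^l, i.e. the ideal
   J_i(gamma) generated by the Jacobi expressions is contained in p^m. *)
Definition Ldefined (i m : nat) (c : nat -> Kelt) : Prop :=
  (i <= m)%N /\
  forall x y z, Pin i x -> Pin i y -> Pin i z -> Pin m (jacobi c x y z).

(* lower central series of L_{i,m}(gamma), on representatives in p^i:
   lcs 1 = L, lcs (k+1) = additive span of [L, lcs k]  (mod p^m) *)
Fixpoint lcs (i m : nat) (c : nat -> Kelt) (k : nat) (x : PO p) : Prop :=
  match k with
  | 0 | 1 => Pin i x
  | k'.+1 =>
      exists s : seq (PO p * PO p),
        (forall q, List.In q s -> Pin i q.1 /\ lcs i m c k' q.2) /\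
        Pin m (Osub x (Osum [seq gamO c q.1 q.2 | q <- s]))
  end.

Definition class_le (i m : nat) (c : nat -> Kelt) (cl : nat) : Prop :=
  forall x, lcs i m c cl.+1 x -> Pin m x.

(* ---------- Lazard correspondence: BCH in Dynkin's form ---------- *)
(* all sequences [(r_1,s_1);...;(r_n,s_n)] with r_k + s_k > 0 and total w *)
Fixpoint blocks (fuel w : nat) : seq (seq (nat * nat)) :=
  if w is 0 then [:: [::]] else
  match fuel with
  | 0 => [::]
  | fuel'.+1 =>
      flatten [seq [seq rs :: t | t <- blocks fuel' (w - (rs.1 + rs.2))]
              | rs <- [seq (r, (t - r)%N) | t <- iota 1 w, r <- iota 0 t.+1]]
  end.

(* terms of total degree <= p - 1 (class <= p-1) *)
Definition dyn_blocks : seq (seq (nat * nat)) :=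
  flatten [seq blocks w w | w <- iota 1 p.-1].

(* denominator n * (sum (r_k + s_k)) * prod (r_k! s_k!) -- prime to p *)
Definition dyn_den (bl : seq (nat * nat)) : nat :=
  (size bl * sumn [seq (rs.1 + rs.2)%N | rs <- bl] *
   foldr (fun rs acc => rs.1`! * rs.2`! * acc) 1 bl)%N.

(* the coefficient (-1)^(n-1)/den, acting on p^i/p^m (killed by p^m):
   1/den is realised by an integer inverse of den modulo p^m *)
Definition dyn_coef (m : nat) (bl : seq (nat * nat)) : int :=
  (-1) ^+ (size bl).-1 * ((egcdn (dyn_den bl) (p ^ m)).1)%:Z.

Fixpoint nest (br : PO p -> PO p -> PO p) (l : seq (PO p)) : PO p :=
  match l with
  | [::] => Ozero
  | [:: z] => z
  | z :: t => br z (nest br t)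
  end.

Definition dyn_word (x y : PO p) (bl : seq (nat * nat)) : seq (PO p) :=
  flatten [seq nseq rs.1 x ++ nseq rs.2 y | rs <- bl].

Definition lazmul (m : nat) (c : nat -> Kelt) (x y : PO p) : PO p :=
  Osum [seq Oint (dyn_coef m bl) (nest (gamO c) (dyn_word x y bl)) | bl <- dyn_blocks].

(* elements: (x, j) standing for (x + p^m, theta^j), x in p^i, j < p *)
Definition inS (i : nat) (s : PO p * nat) : Prop := Pin i s.1 /\ (s.2 < p)%N.
Definition eqS (m : nat) (s t : PO p * nat) : Prop :=
  Pin m (Osub s.1 t.1) /\ s.2 = t.2.
Definition smul (m : nat) (c : nat -> Kelt) (s t : PO p * nat) : PO p * nat :=
  (lazmul m c s.1 (Omul (Opow Otheta s.2) t.1), ((s.2 + t.2) %% p)%N).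

Definition S_iso (i m : nat) (c c' : nat -> Kelt) : Prop :=
  exists f : PO p * nat -> PO p * nat,
    (forall s, inS i s -> inS i (f s)) /\
    (forall s t, inS i s -> inS i t -> (eqS m (f s) (f t) <-> eqS m s t)) /\
    (forall t, inS i t -> exists s, inS i s /\ eqS m (f s) t) /\
    (forall s t, inS i s -> inS i t ->
       eqS m (f (smul m c s t)) (smul m c' (f s) (f t))).
End Ops.

(* Main.v *)
Require Import Defs.
From HB Require Import structures.
From mathcomp Require Import all_boot all_algebra.
From mathcomp Require Import ring zify.
From Stdlib Require Import FunctionalExtensionality ClassicalEpsilon.

(* Since [vartheta_a] commutes with [sigma] and
   [vartheta_a (u x) (u y) = u * rho_a(u) * vartheta_a x y], the congruences say
   that [phi x = u * sigma x] satisfies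
   [phi (gamma' (x, y)) = gamma (phi x, phi y)] modulo [p^m] on [p^i]; this is
   checked after multiplication by a power of [p] clearing the denominators of the
   [c_a] and [c'_a].  The inverse [psi] of [phi] is thus an isomorphism from
   [L_{i,m}(gamma)] onto [L_{i,m}(gamma')], hence of the Lazard groups, and it maps
   multiplication by [theta] to multiplication by [sigma^-1 theta].  So
   [(x, theta^k) |-> (psi x, sigma^-1 theta^k)] is the required isomorphism.
   That [p^m] is an ideal for [gamma'], which evaluating iterated brackets modulo
   [p^m] needs, comes from the bound on the class. *)

Set Implicit Arguments.
Unset Strict Implicit.
Unset Printing Implicit Defensive.
Import GRing.Theory Pdiv.Ring Pdiv.RingMonic.
Local Open Scope ring_scope.

(** * The ring [R[x] / (1 + x + ... + x^(p-1))] *)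

Section Quotient.
Variables (R : comNzRingType) (p : nat).
Hypothesis Hp : prime p.

Let p_gt0 : (0 < p)%N. Proof. exact: prime_gt0. Qed.
Let p_gt1 : (1 < p)%N. Proof. exact: prime_gt1. Qed.

Definition Phi : {poly R} := \sum_(s < p) 'X^s.

Lemma Phi_poly : Phi = \poly_(s < p) 1.
Proof. by rewrite poly_def; apply: eq_bigr => s _; rewrite scale1r. Qed.

Lemma size_Phi : size Phi = p.
Proof. by rewrite Phi_poly size_poly_eq // oner_eq0. Qed.

Lemma Phi_monic : Phi \is monic.
Proof.
by rewrite monicE lead_coefE size_Phi Phi_poly coef_poly ltn_predL p_gt0.
Qed.

Lemma PhiM : Phi * ('X - 1) = 'X^p - 1.
Proof. by rewrite [in RHS]subrX1 mulrC. Qed.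

(** The passage from polynomials to coordinates modulo [Phi], with [rVpoly] as a section. The ring
    laws for [cmul] and the properties of [csig] are pulled back along it from [{poly R}]. *)
Definition cyc_of (f : {poly R}) : 'rV[R]_(p.-1) := poly_rV (rmodp f Phi).

Lemma cyc_of_rVpoly v : cyc_of (rVpoly v) = v.
Proof.
rewrite /cyc_of rmodp_small ?rVpolyK // size_Phi.
by rewrite (leq_ltn_trans (size_poly _ _)) // ltn_predL.
Qed.

Lemma rVpoly_cyc_of f : rVpoly (cyc_of f) = rmodp f Phi.
Proof.
apply: poly_rV_K; rewrite -ltnS prednK // -[X in (_ < X)%N]size_Phi.
by rewrite ltn_rmodp monic_neq0 // Phi_monic.
Qed.

Lemma cyc_ofD f g : cyc_of (f + g) = cyc_of f + cyc_of g.
Proof. by rewrite /cyc_of rmodpD ?Phi_monic // linearD. Qed.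

Lemma cyc_ofZ a f : cyc_of (a *: f) = a *: cyc_of f.
Proof. by rewrite /cyc_of rmodpZ ?Phi_monic // linearZ. Qed.

Lemma cyc_of0 : cyc_of 0 = 0.
Proof. by rewrite -[0 in LHS](scale0r 0) cyc_ofZ scale0r. Qed.

Lemma cyc_of_sum I (r : seq I) (P : pred I) F :
  cyc_of (\sum_(i <- r | P i) F i) = \sum_(i <- r | P i) cyc_of (F i).
Proof. exact: (big_morph _ cyc_ofD cyc_of0). Qed.

Lemma cyc_of_mul_Phi f : cyc_of (f * Phi) = 0.
Proof. by rewrite /cyc_of rmodp_mull ?Phi_monic // linear0. Qed.

(** The geometric sum shows that [X^(pq) - 1] is a multiple of [X^p - 1 = Phi * (X - 1)], so [X^p]
    acts as [1] on classes. *)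
Lemma cyc_ofXmod s : cyc_of 'X^(s %% p) = cyc_of 'X^s.
Proof.
rewrite [in RHS](divn_eq s p) exprD mulnC exprM.
have -> : ('X^p ^+ (s %/ p) * 'X^(s %% p) : {poly R}) =
   'X^(s %% p) + ('X^(s %% p) * (\sum_(k < s %/ p) 'X^p ^+ k) * ('X - 1)) * Phi.
  have := @subrX1 _ ('X^p : {poly R}) (s %/ p); rewrite -PhiM => H.
  have -> : ('X^p ^+ (s %/ p) : {poly R}) = 1 + ('X^p ^+ (s %/ p) - 1) by ring.
  by rewrite H; ring.
by rewrite cyc_ofD cyc_of_mul_Phi addr0.
Qed.

Lemma rVpolyE (v : 'rV[R]_(p.-1)) : rVpoly v = \sum_(t < p.-1) v 0 t *: 'X^t.
Proof. by rewrite /rVpoly poly_def; apply: eq_bigr => t _; rewrite valK. Qed.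

Lemma ebasisE s : (s < p)%N -> ebasis R p s = cyc_of 'X^s.
Proof.
move=> lt_s; have [ltsp|ges] := ltnP s p.-1.
  have -> : 'X^s = rVpoly (delta_mx 0 (Ordinal ltsp)) :> {poly R}.
    by rewrite rVpoly_delta.
  rewrite cyc_of_rVpoly; apply/rowP => t; rewrite !mxE eqxx andTb.
  by rewrite -val_eqE /= eq_sym (ltn_eqF ltsp); case: eqP.
have -> : s = p.-1 by apply/eqP; rewrite eqn_leq ges andbT -ltnS prednK.
(* In the top degree the row of [-1] differs from [X^(p-1)] by exactly one copy of [Phi]. *)
have -> : 'X^(p.-1) = rVpoly (\row_(t < p.-1) (-1 : R)) + 1 * Phi.
  rewrite mul1r /Phi.
  have -> : \sum_(s0 < p) ('X^s0 : {poly R}) = \sum_(s0 < p.-1.+1) 'X^s0.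
    by rewrite prednK.
  rewrite big_ord_recr /= addrA rVpolyE -big_split big1 ?add0r //= => t _.
  by rewrite mxE scaleN1r addNr.
rewrite cyc_ofD cyc_of_mul_Phi addr0 cyc_of_rVpoly; apply/rowP => t.
by rewrite !mxE eqxx eq_sym (ltn_eqF (ltn_ord t)).
Qed.

Lemma ebasis_mod s : ebasis R p (s %% p) = cyc_of 'X^s.
Proof. by rewrite ebasisE ?ltn_pmod // cyc_ofXmod. Qed.

Lemma cmulE x y : cmul p x y = cyc_of (rVpoly x * rVpoly y).
Proof.
rewrite !rVpolyE mulr_suml cyc_of_sum; apply: eq_bigr => s _.
rewrite mulr_sumr cyc_of_sum; apply: eq_bigr => t _.
by rewrite ebasis_mod -cyc_ofZ -scalerAl -scalerAr scalerA exprD.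
Qed.

Lemma cyc_ofM f g : cyc_of (f * g) = cmul p (cyc_of f) (cyc_of g).
Proof.
rewrite cmulE !rVpoly_cyc_of /cyc_of.
by rewrite rmodp_mulml ?rmodp_mulmr ?Phi_monic.
Qed.

(** Multiplication by [j] permutes the residues modulo [p] and only residues of exponents matter, so
    [Phi(X^j)] has the class of [Phi]. Hence the substitution [X -> X^j] descends to the
    quotient. *)
Lemma comp_PhiXn j : coprime j p -> cyc_of (Phi \Po 'X^j) = 0.
Proof.
move=> cop; rewrite /Phi linear_sum /= cyc_of_sum.
transitivity (\sum_(s < p) cyc_of 'X^s); last first.
  by rewrite -cyc_of_sum -[X in cyc_of X]mul1r cyc_of_mul_Phi.
pose h (s : 'I_p) : 'I_p := Ordinal (ltn_pmod (j * s) p_gt0).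
have h_inj : injective h.
  move=> s t /(congr1 val) /= /eqP.
  wlog le_st : s t / (t <= s)%N.
    move=> W; case/orP: (leq_total t s) => le; first exact: W.
    by move=> e; symmetry; apply: W => //; rewrite eq_sym.
  rewrite eqn_mod_dvd ?leq_mul2l ?le_st ?orbT // -mulnBr Gauss_dvdr 1?coprime_sym //.
  have lt : (s - t < p)%N := leq_ltn_trans (leq_subr _ _) (ltn_ord s).
  case: (posnP (s - t)) => [/eqP|gt0 /(dvdn_leq gt0)]; last by rewrite leqNgt lt.
  by rewrite subn_eq0 => le _; apply/val_inj/eqP; rewrite eqn_leq le le_st.
rewrite [RHS](reindex_inj h_inj); apply: eq_bigr => s _ /=.
by rewrite comp_Xn_poly -exprM cyc_ofXmod.
Qed.

Lemma csigE j x : csig p j x = cyc_of (rVpoly x \Po 'X^j).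
Proof.
rewrite rVpolyE linear_sum cyc_of_sum; apply: eq_bigr => s _ /=.
by rewrite ebasis_mod comp_polyZ comp_Xn_poly cyc_ofZ exprM.
Qed.

Lemma csig_cyc_of j f : coprime j p ->
  csig p j (cyc_of f) = cyc_of (f \Po 'X^j).
Proof.
move=> cop; rewrite csigE rVpoly_cyc_of.
rewrite [in RHS](rdivp_eq Phi_monic f) comp_polyD comp_polyM cyc_ofD cyc_ofM.
by rewrite comp_PhiXn // -[0]cyc_of0 -cyc_ofM mulr0 cyc_of0 add0r.
Qed.

(** An alias of the row vectors that carries multiplication by [cmul]. The proof of primality is an
    argument because the ring laws depend on it. *)
Definition cyc of prime p := 'rV[R]_(p.-1).
Local Notation cy := (cyc Hp).
HB.instance Definition _ := GRing.Zmodule.on cy.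

Lemma cyc_mulA : associative (cmul p : cy -> cy -> cy).
Proof.
move=> x y z; rewrite -[x]cyc_of_rVpoly -[y]cyc_of_rVpoly -[z]cyc_of_rVpoly.
by rewrite -!cyc_ofM mulrA.
Qed.

Lemma cyc_mulC : commutative (cmul p : cy -> cy -> cy).
Proof. by move=> x y; rewrite !cmulE mulrC. Qed.

Lemma cyc_mul1 : left_id (ebasis R p 0 : cy) (cmul p).
Proof.
move=> x; rewrite -[x]cyc_of_rVpoly ebasisE // -cyc_ofM.
by rewrite expr0 mul1r.
Qed.

Lemma cyc_mulDl : left_distributive (cmul p : cy -> cy -> cy) +%R.
Proof. by move=> x y z; rewrite !cmulE linearD mulrDl cyc_ofD. Qed.

Lemma cyc_one_neq0 : (ebasis R p 0 : cy) != 0.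
Proof.
have lt0 : (0 < p.-1)%N by rewrite -ltnS prednK.
apply/eqP => /rowP /(_ (Ordinal lt0)); rewrite !mxE eqxx => /eqP.
by rewrite oner_eq0.
Qed.

HB.instance Definition _ := GRing.Zmodule_isComNzRing.Build cy
  cyc_mulA cyc_mulC cyc_mul1 cyc_mulDl cyc_one_neq0.

Definition cyc_theta : cy := ebasis R p 1.
Definition cyc_sigma (j : nat) (x : cy) : cy := csig p j x.

Lemma cyc_sigmaD j x y : cyc_sigma j (x + y) = cyc_sigma j x + cyc_sigma j y.
Proof. by rewrite /cyc_sigma !csigE linearD comp_polyD cyc_ofD. Qed.

Lemma cyc_sigma0 j : cyc_sigma j 0 = 0.
Proof. by rewrite /cyc_sigma csigE linear0 comp_poly0 cyc_of0. Qed.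

Lemma cyc_sigmaN j x : cyc_sigma j (- x) = - cyc_sigma j x.
Proof. by apply/eqP; rewrite -addr_eq0 -cyc_sigmaD addNr cyc_sigma0. Qed.

Lemma cyc_sigmaMn j x n : cyc_sigma j (x *+ n) = cyc_sigma j x *+ n.
Proof. by elim: n => [|n IH]; rewrite ?mulr0n ?cyc_sigma0 // !mulrS cyc_sigmaD IH. Qed.

Lemma cyc_sigma_sum j I (r : seq I) (F : I -> cy) :
  cyc_sigma j (\sum_(k <- r) F k) = \sum_(k <- r) cyc_sigma j (F k).
Proof. exact: (big_morph _ (cyc_sigmaD j) (cyc_sigma0 j)). Qed.

Lemma cyc_ofMr f g : cyc_of (f * g) = (cyc_of f : cy) * (cyc_of g : cy).
Proof. exact: cyc_ofM. Qed.

Lemma cyc_sigmaM j x y : coprime j p ->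
  cyc_sigma j (x * y) = cyc_sigma j x * cyc_sigma j y.
Proof.
move=> cop; rewrite /cyc_sigma -[x]cyc_of_rVpoly -[y]cyc_of_rVpoly -cyc_ofMr.
by rewrite !csig_cyc_of // comp_polyM cyc_ofMr.
Qed.

Lemma cyc_of1 : cyc_of 1 = 1 :> cy.
Proof. by rewrite -(expr0 'X) -ebasisE. Qed.

Lemma cyc_ofX : cyc_of 'X = cyc_theta.
Proof. by rewrite -(expr1 'X) -ebasisE. Qed.

Lemma cyc_ofXn n : cyc_of 'X^n = cyc_theta ^+ n.
Proof.
elim: n => [|n IH]; first by rewrite !expr0 cyc_of1.
by rewrite !exprS cyc_ofMr IH cyc_ofX.
Qed.

Lemma cyc_sigma1 j : coprime j p -> cyc_sigma j 1 = 1.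
Proof. by move=> cop; rewrite -[in LHS]cyc_of1 /cyc_sigma csig_cyc_of // comp_polyC cyc_of1. Qed.

Lemma cyc_sigma_theta j : coprime j p -> cyc_sigma j cyc_theta = cyc_theta ^+ j.
Proof. by move=> cop; rewrite -[in LHS]cyc_ofX /cyc_sigma csig_cyc_of // comp_polyX cyc_ofXn. Qed.

Lemma cyc_sigmaX j x n : coprime j p -> cyc_sigma j (x ^+ n) = cyc_sigma j x ^+ n.
Proof.
by move=> cop; elim: n => [|n IH]; rewrite ?expr0 ?cyc_sigma1 // !exprS cyc_sigmaM ?IH.
Qed.

Lemma cyc_sigma_pi j : coprime j p ->
  cyc_sigma j (cyc_theta - 1) = (cyc_theta - 1) * \sum_(s < j) cyc_theta ^+ s.
Proof.
by move=> cop; rewrite cyc_sigmaD cyc_sigmaN cyc_sigma1 // cyc_sigma_theta // subrX1.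
Qed.

Lemma cyc_theta_p : cyc_theta ^+ p = 1.
Proof. by rewrite -cyc_ofXn -cyc_ofXmod modnn expr0 cyc_of1. Qed.

Lemma cyc_theta_sum : \sum_(s < p) cyc_theta ^+ s = 0.
Proof.
under eq_bigr do rewrite -cyc_ofXn.
by rewrite -cyc_of_sum -[X in cyc_of X]mul1r cyc_of_mul_Phi.
Qed.

Lemma cyc_sigma_comp j k x : coprime j p ->
  cyc_sigma j (cyc_sigma k x) = cyc_sigma (j * k) x.
Proof.
move=> cop; rewrite /cyc_sigma [csig p k x]csigE csig_cyc_of // -comp_polyA.
by rewrite csigE comp_Xn_poly exprM.
Qed.

Lemma cyc_sigma_mod j x : cyc_sigma (j %% p) x = cyc_sigma j x.
Proof. by rewrite /cyc_sigma /csig; under eq_bigr do rewrite modnMml. Qed.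

Lemma cyc_sigma_id x : cyc_sigma 1 x = x.
Proof. by rewrite /cyc_sigma csigE expr1 comp_polyXr cyc_of_rVpoly. Qed.

End Quotient.

(** * Change of coefficient ring, and binomial sums *)

Lemma map_ebasis (R S : comNzRingType) (h : {rmorphism R -> S}) p s :
  map_mx h (ebasis R p s) = ebasis S p s.
Proof.
by apply/rowP => t; rewrite !mxE; case: ifP => _; rewrite ?rmorph1 //;
  case: ifP => _; rewrite ?rmorphN1 ?rmorph0.
Qed.

Lemma map_cmul (R S : comNzRingType) (h : {rmorphism R -> S}) p x y :
  map_mx h (cmul p x y) = cmul p (map_mx h x) (map_mx h y).
Proof.
rewrite /cmul raddf_sum; apply: eq_bigr => s _.
rewrite raddf_sum; apply: eq_bigr => t _ /=.
by rewrite map_mxZ rmorphM map_ebasis !mxE.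
Qed.

Lemma map_csig (R S : comNzRingType) (h : {rmorphism R -> S}) p j x :
  map_mx h (csig p j x) = csig p j (map_mx h x).
Proof.
rewrite /csig raddf_sum; apply: eq_bigr => s _ /=.
by rewrite map_mxZ map_ebasis mxE.
Qed.

(** The expansion of [((1 + x)^n - 1) / x] written without division, proved by Pascal's rule. It
    will be applied to [x = theta - 1] and [n = p]. *)
Lemma sum_exprD1 (R : comNzRingType) (x : R) n :
  \sum_(s < n) (1 + x) ^+ s = \sum_(k < n) x ^+ k *+ 'C(n, k.+1).
Proof.
elim: n => [|n IH]; first by rewrite !big_ord0.
rewrite big_ord_recr IH /=.
under [RHS]eq_bigr do rewrite binS mulrnDr.
rewrite big_split big_ord_recr /= bin_small // mulr0n addr0; congr (_ + _).
by rewrite exprDn; apply: eq_bigr => k _; rewrite expr1n mul1r.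
Qed.

Lemma sum_exprD1_pred (R : comNzRingType) (x : R) n : (0 < n)%N ->
  \sum_(s < n) (1 + x) ^+ s = x ^+ n.-1 + \sum_(k < n.-1) x ^+ k *+ 'C(n, k.+1).
Proof. by case: n => // n _; rewrite sum_exprD1 big_ord_recr /= binn addrC. Qed.

Lemma sum_iota0 (V : nmodType) (F : nat -> V) k :
  \sum_(s <- iota 0 k) F s = \sum_(s < k) F s.
Proof. by rewrite -(big_mkord xpredT F) /index_iota subn0. Qed.

(** * The ring [O] and the ideals [p^j] *)

Section Padic.
Variable p : nat.
Hypothesis Hp : prime p.

Let p_gt0 : (0 < p)%N. Proof. exact: prime_gt0. Qed.

Lemma pX_gt1 n : (1 < p ^ n.+1)%N.
Proof. by rewrite -{1}(exp1n n.+1) ltn_exp2r // prime_gt1. Qed.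

(** The transition map inside [isO], named so that it can carry the structure of a ring morphism. *)
Definition red n (z : 'Z_(p ^ n.+2)) : 'Z_(p ^ n.+1) := inZp (nat_of_ord z).

Lemma redE n z : red z = (nat_of_ord z)%:R :> 'Z_(p ^ n.+1).
Proof. by rewrite Zp_nat. Qed.

Lemma natr_Zp_eq n a b :
  (a%:R = b%:R :> 'Z_(p ^ n.+1)) <-> a = b %[mod p ^ n.+1].
Proof.
split=> [/(congr1 val) /=|e]; last by apply/val_inj; rewrite !Zp_nat /= Zp_cast ?pX_gt1.
by rewrite !val_Zp_nat ?pX_gt1.
Qed.

Lemma red_nat n k : red (k%:R : 'Z_(p ^ n.+2)) = k%:R.
Proof.
rewrite redE; apply/natr_Zp_eq; rewrite val_Zp_nat ?pX_gt1 //.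
by rewrite modn_dvdm // dvdn_exp2l.
Qed.

Lemma red_is_nmod_morphism n : nmod_morphism (@red n).
Proof.
split=> [|x y]; first exact: (red_nat n 0).
by rewrite -[x]natr_Zp -[y]natr_Zp -natrD !red_nat natrD.
Qed.

Lemma red_is_monoid_morphism n : monoid_morphism (@red n).
Proof.
split=> [|x y]; first exact: (red_nat n 1).
by rewrite -[x]natr_Zp -[y]natr_Zp -natrM !red_nat natrM.
Qed.

HB.instance Definition _ n :=
  GRing.isNmodMorphism.Build _ _ (@red n) (@red_is_nmod_morphism n).
HB.instance Definition _ n :=
  GRing.isMonoidMorphism.Build _ _ (@red n) (@red_is_monoid_morphism n).

(** The levels have [p]-torsion, so cancelling one factor [p] costs one level. *)
Lemma red_torsion n k (z : 'Z_(p ^ n.+2)) : z *+ p ^ k.+1 = 0 -> red z *+ p ^ k = 0.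
Proof.
rewrite redE -{1}[z]natr_Zp; move: (nat_of_ord z) => a.
rewrite -[X in X = 0 -> _]mulrnA -[X in _ -> X = 0]mulrnA => e.
have {e} /natr_Zp_eq e : (a * p ^ k.+1)%:R = 0%:R :> 'Z_(p ^ n.+2) by [].
suff /natr_Zp_eq : (a * p ^ k)%N = 0%N %[mod p ^ n.+1] by [].
rewrite !mod0n in e *; apply/eqP; move/eqP: e; rewrite -!/(dvdn _ _).
by rewrite (expnS _ k) (expnS _ n.+1) mulnCA dvdn_pmul2l.
Qed.

Definition zl n : comNzRingType := 'Z_(p ^ n.+1).
(** The component at level [n], seen in the commutative ring [cyc]. Identities in [O] are proved at
    each level there. *)
Definition lv (x : PO p) n : cyc (zl n) Hp := x n.
Local Notation th n := (cyc_theta (zl n) Hp).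

Lemma lv_inj x y : (forall n, lv x n = lv y n) -> x = y.
Proof. exact: functional_extensionality_dep. Qed.

Lemma lv0 n : lv (Ozero p) n = 0. Proof. by []. Qed.
Lemma lv1 n : lv (Oone p) n = 1. Proof. by []. Qed.
Lemma lvtheta n : lv (Otheta p) n = th n. Proof. by []. Qed.
Lemma lvD x y n : lv (Oadd x y) n = lv x n + lv y n. Proof. by []. Qed.
Lemma lvN x n : lv (Oopp x) n = - lv x n. Proof. by []. Qed.
Lemma lvB x y n : lv (Osub x y) n = lv x n - lv y n. Proof. by []. Qed.
Lemma lvM x y n : lv (Omul x y) n = lv x n * lv y n. Proof. by []. Qed.
Lemma lvpi n : lv (Opi p) n = th n - 1. Proof. by []. Qed.
Lemma lvsig j x n : lv (Osig j x) n = cyc_sigma j (lv x n). Proof. by []. Qed.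

Lemma lvX x k n : lv (Opow x k) n = lv x n ^+ k.
Proof. by elim: k => [|k IH]; rewrite ?expr0 // exprS -IH. Qed.

Lemma lvMn x k n : lv (Onat k x) n = lv x n *+ k.
Proof. by elim: k => [|k IH] //; rewrite mulrS -IH /lv /Onat mulrS. Qed.

Lemma lvMz x z n : lv (Oint z x) n = lv x n *~ z.
Proof.
by case: z => k; [exact: lvMn | exact: (congr1 -%R (lvMn x k.+1 n))].
Qed.

Lemma lvsum s n : lv (Osum s) n = \sum_(x <- s) lv x n.
Proof. by elim: s => [|x s IH]; rewrite ?big_nil // big_cons -IH. Qed.

Definition lvE := (lv0, lv1, lvtheta, lvD, lvN, lvB, lvpi, lvsig, lvM, lvX, lvMn, lvMz, lvsum).

Lemma isOE (x : PO p) : isO x <-> forall n, map_mx (@red n) (x n.+1) = x n.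
Proof. by []. Qed.

Lemma isO0 : isO (Ozero p).
Proof. by apply/isOE => n; exact: map_mx0. Qed.

Lemma isO1 : isO (Oone p).
Proof. by apply/isOE => n; exact: map_ebasis. Qed.

Lemma isO_theta : isO (Otheta p).
Proof. by apply/isOE => n; exact: map_ebasis. Qed.

Lemma isOD (x y : PO p) : isO x -> isO y -> isO (Oadd x y).
Proof. by move=> /isOE hx /isOE hy; apply/isOE => n; rewrite map_mxD hx hy. Qed.

Lemma isON (x : PO p) : isO x -> isO (Oopp x).
Proof. by move=> /isOE hx; apply/isOE => n; rewrite map_mxN hx. Qed.

Lemma isOB (x y : PO p) : isO x -> isO y -> isO (Osub x y).
Proof. by move=> hx hy; apply: isOD => //; apply: isON. Qed.

Lemma isOM (x y : PO p) : isO x -> isO y -> isO (Omul x y).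
Proof. by move=> /isOE hx /isOE hy; apply/isOE => n; rewrite map_cmul hx hy. Qed.

Lemma isOX (x : PO p) k : isO x -> isO (Opow x k).
Proof. by move=> hx; elim: k => [|k IH]; [exact: isO1 | exact: isOM]. Qed.

Lemma isOMn (x : PO p) k : isO x -> isO (Onat k x).
Proof. by move=> /isOE hx; apply/isOE => n; rewrite raddfMn /= hx. Qed.

Lemma isOMz (x : PO p) z : isO x -> isO (Oint z x).
Proof. by move=> /isOE hx; apply/isOE => n; rewrite raddfMz /= hx. Qed.

Lemma isO_sig j (x : PO p) : isO x -> isO (Osig j x).
Proof. by move=> /isOE hx; apply/isOE => n; rewrite map_csig hx. Qed.

Lemma isO_sum (s : seq (PO p)) : (forall x, List.In x s -> isO x) -> isO (Osum s).
Proof.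
elim: s => [|x s IH] h; first exact: isO0.
by apply: isOD; [apply: h; left | apply: IH => y ys; apply: h; right].
Qed.

Lemma isO_pi : isO (Opi p).
Proof. exact: isOB isO_theta isO1. Qed.

(** The ring [O] is torsion-free although its levels are not: what happens at level [n] is read off
    from level [n + 1] by [red_torsion], one factor [p] at a time. *)
Lemma isO_torsion (z : PO p) k : isO z -> (forall n, lv z n *+ (p ^ k) = 0) -> z = Ozero p.
Proof.
elim: k z => [|k IH] z hz h; first by apply: lv_inj => n; rewrite -[LHS]mulr1n h.
apply: IH => // n; move: (h n.+1) => hn.
apply/rowP => t; have := congr1 (fun M : 'rV__ => M 0 t) hn.
rewrite -!lvMn /lv /Onat /= -(hz n) !mxE !mulmxnE mxE.
exact: red_torsion.
Qed.

Local Opaque Ozero Oone Otheta Oadd Oopp Osub Omul Opow Onat Oint Osig Osum Opi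
  zl lv cyc_sigma cyc_theta.

(** This permits proving identities between brackets after clearing the denominators of the
    [c_a]. *)
Lemma isO_cancel (x y : PO p) k : isO x -> isO y ->
  (forall n, lv x n *+ (p ^ k) = lv y n *+ (p ^ k)) -> x = y.
Proof.
move=> hx hy h; apply: lv_inj => n; apply/eqP; rewrite -subr_eq0 -lvB.
rewrite (@isO_torsion (Osub x y) k) //; first exact: isOB.
by move=> r; rewrite lvB mulrnBl h subrr.
Qed.

Lemma Pin_isO j (x : PO p) : Pin j x -> isO x.
Proof. by case. Qed.

Lemma PinP j (x : PO p) : Pin j x <->
  exists2 y, isO y & forall n, lv x n = (th n - 1) ^+ j * lv y n.
Proof.
split=> [[_ [y [hy ->]]]|[y hy e]]; first by exists y => // n; rewrite !lvE.
have -> : x = Omul (Opow (Opi p) j) y by apply: lv_inj => n; rewrite e !lvE.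
split; last by exists y.
by apply: isOM => //; apply: isOX isO_pi.
Qed.

Lemma Pin0 j : Pin j (Ozero p).
Proof. by apply/PinP; exists (Ozero p) => [|n]; rewrite ?lvE ?mulr0 //; exact: isO0. Qed.

Lemma PinD j (x y : PO p) : Pin j x -> Pin j y -> Pin j (Oadd x y).
Proof.
move=> /PinP [a ha ea] /PinP [b hb eb]; apply/PinP; exists (Oadd a b).
  exact: isOD.
by move=> n; rewrite !lvE ea eb mulrDr.
Qed.

Lemma PinM j (a x : PO p) : isO a -> Pin j x -> Pin j (Omul a x).
Proof.
move=> ha /PinP [b hb eb]; apply/PinP; exists (Omul a b); first exact: isOM.
by move=> n; rewrite !lvE eb mulrCA.
Qed.

Lemma PinN j (x : PO p) : Pin j x -> Pin j (Oopp x).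
Proof.
move=> /PinP [b hb eb]; apply/PinP; exists (Oopp b); first exact: isON.
by move=> n; rewrite !lvE eb mulrN.
Qed.

Lemma PinB j (x y : PO p) : Pin j x -> Pin j y -> Pin j (Osub x y).
Proof. by move=> hx hy; apply: PinD => //; apply: PinN. Qed.

Lemma PinMz j z (x : PO p) : Pin j x -> Pin j (Oint z x).
Proof.
move=> /PinP [b hb eb]; apply/PinP; exists (Oint z b); first exact: isOMz.
by move=> n; rewrite !lvE eb mulrzAr.
Qed.

Lemma Pin_le j k (x : PO p) : (j <= k)%N -> Pin k x -> Pin j x.
Proof.
move=> le /PinP [b hb eb]; apply/PinP.
exists (Omul (Opow (Opi p) (k - j)) b); first by apply: isOM => //; apply: isOX isO_pi.
by move=> n; rewrite eb !lvE mulrA -exprD subnKC.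
Qed.

(** With [pi = theta - 1], one has [sigma_k(pi) = theta^k - 1 = pi * (1 + theta + ... +
    theta^(k-1))]; the witness collects the [j]-th power of the second factor. *)
Lemma Pin_sig k j (x : PO p) : coprime k p -> Pin j x -> Pin j (Osig k x).
Proof.
move=> cop /PinP [b hb eb]; apply/PinP.
exists (Omul (Opow (Osum [seq Opow (Otheta p) s | s <- iota 0 k]) j) (Osig k b)).
  apply: isOM; last exact: isO_sig.
  apply: isOX; apply: isO_sum => x1 /List.in_map_iff [s [<- _]].
  exact: isOX isO_theta.
move=> n; rewrite !lvE eb (cyc_sigmaM _ _ cop) (cyc_sigmaX _ _ cop).
rewrite (cyc_sigma_pi _ _ cop).
rewrite exprMn -mulrA big_map sum_iota0.
by under [in RHS]eq_bigr do rewrite !lvE.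
Qed.

(** Expanding [1 + theta + ... + theta^(p-1) = 0] at [theta = 1 + pi] expresses [pi^(p-1)] through
    lower powers of [pi] with coefficients [-'C(p, k+1)], all divisible by [p]. *)
Lemma pi_exp_p : exists2 e : PO p, isO e & forall n, (th n - 1) ^+ p.-1 = lv e n *+ p.
Proof.
exists (Oopp (Osum [seq Onat ('C(p, k.+1) %/ p) (Opow (Opi p) k) | k <- iota 0 p.-1])).
  apply: isON; apply: isO_sum => x1 /List.in_map_iff [s [<- _]].
  by apply: isOMn; apply: isOX isO_pi.
move=> n; have := sum_exprD1_pred (th n - 1) p_gt0.
have -> : 1 + (th n - 1) = th n by rewrite addrC subrK.
rewrite cyc_theta_sum => /esym/eqP; rewrite addr_eq0 => /eqP ->.
rewrite !lvE mulNrn -sumrMnl big_map sum_iota0; congr (- _).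
apply: eq_bigr => k _; rewrite !lvE -mulrnA divnK //.
apply: prime_dvd_bin => //=.
by rewrite -[X in (_ < X)%N](prednK p_gt0) ltnS ltn_ord.
Qed.

(** By [pi_exp_p], the factor [pi^(k(p-1))] is a multiple of [p^k]. This turns [Kin j] for a
    fraction with denominator [p^k] into an honest quotient in [O]. *)
Lemma Pin_div j k (d : PO p) : Pin (j + k * p.-1) d ->
  exists2 D, Pin j D & forall n, lv d n = lv D n *+ p ^ k.
Proof.
move=> /PinP [b hb eb]; have [e he ee] := pi_exp_p.
exists (Omul (Omul (Opow e k) b) (Opow (Opi p) j)).
  apply: PinM; first by apply: isOM => //; apply: isOX.
  apply/PinP; exists (Oone p); first exact: isO1.
  by move=> n; rewrite !lvE mulr1.
move=> n; rewrite eb !lvE exprD mulnC exprM ee.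
rewrite -mulr_natr exprMn -natrX -mulr_natr; ring.
Qed.
End Padic.

(** * The maps [vartheta_a] at a finite level *)

Lemma arange_coprime p a : prime p -> a \in arange p -> coprime a p /\ coprime (p.+1 - a) p.
Proof.
move=> Hp; have p_gt0 := prime_gt0 Hp; have p_gt1 := prime_gt1 Hp.
rewrite mem_iota => /andP [a2 aq].
have hp : (p.-1./2 <= p.-1)%N by rewrite -divn2 leq_div.
by split; rewrite coprime_sym prime_coprime // gtnNdvd //; lia.
Qed.

Lemma arange_bounds p a : a \in arange p -> (2 <= a <= p.-1./2)%N.
Proof. by rewrite mem_iota; lia. Qed.

Section Vartheta.
Variables (R : comNzRingType) (p : nat).
Hypothesis Hp : prime p.
Local Notation cy := (cyc R Hp).

Definition vth a (x y : cy) : cy :=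
  cyc_sigma a x * cyc_sigma (p.+1 - a) y - cyc_sigma (p.+1 - a) x * cyc_sigma a y.

Lemma vth_anti a x y : vth a y x = - vth a x y.
Proof. by rewrite /vth; ring. Qed.

Lemma vthBl a x x' y : vth a (x - x') y = vth a x y - vth a x' y.
Proof. by rewrite /vth !cyc_sigmaD !cyc_sigmaN; ring. Qed.

(** The Galois group is abelian. *)
Lemma vth_sigma j a x y : coprime j p -> a \in arange p ->
  cyc_sigma j (vth a x y) = vth a (cyc_sigma j x) (cyc_sigma j y).
Proof.
move=> cj /(arange_coprime Hp) [ca ca'].
rewrite /vth cyc_sigmaD cyc_sigmaN !(cyc_sigmaM _ _ cj).
by rewrite !cyc_sigma_comp // ![(j * _)%N]mulnC.
Qed.

(** Both products in [vartheta_a] acquire the same factor [sigma_a(u) * sigma_{1-a}(u)], which is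
    [u * rho_a(u)]; here [v] is the inverse of [u]. *)
Lemma vth_mul a u v x y : a \in arange p -> u * v = 1 ->
  vth a (u * x) (u * y) =
  u * (v * (cyc_sigma a u * cyc_sigma (p.+1 - a) u)) * vth a x y.
Proof.
move=> /(arange_coprime Hp) [ca ca'] uv.
rewrite /vth !(cyc_sigmaM _ _ ca) !(cyc_sigmaM _ _ ca') [u * (v * _)]mulrA uv mul1r; ring.
Qed.
End Vartheta.

Lemma lv_vartheta p (Hp : prime p) a (x y : PO p) n :
  lv Hp (vartheta a x y) n = vth a (lv Hp x n) (lv Hp y n).
Proof. by []. Qed.

Lemma Osum_cons p (x : PO p) s : Osum (x :: s) = Oadd x (Osum s).
Proof. by []. Qed.

(* Otherwise failed unification attempts compute in [lv] and in the levels. *)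
Local Opaque Ozero Oone Otheta Oadd Oopp Osub Omul Opow Onat Oint Osig Osum Opi
  zl lv cyc_sigma cyc_theta vth.

(** * The bracket [gamma] *)

Section Gamma.
Variable p : nat.
Hypothesis Hp : prime p.
Local Notation lv := (lv Hp).

Definition Kexp (c : nat -> Kelt p) s := (\sum_(a <- s) (c a).1)%N.

Lemma Kexp_ge c (s : seq nat) a : a \in s -> ((c a).1 <= Kexp c s)%N.
Proof. by move=> sa; rewrite /Kexp (big_rem a) //= leq_addr. Qed.

Lemma gamma_fold c x y s :
  let g := foldr (fun a acc => Kadd (Kmul (c a) (KofO (vartheta a x y))) acc)
             (KofO (Ozero p)) s in
  g.1 = Kexp c s /\
  forall n, lv g.2 n = \sum_(a <- s)
    lv (c a).2 n * vth a (lv x n) (lv y n) *+ p ^ (Kexp c s - (c a).1).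
Proof.
elim: s => [|a s [IH1 IH2]] /=.
  by split=> [|n]; rewrite /Kexp !big_nil.
have KE : Kexp c (a :: s) = ((c a).1 + Kexp c s)%N by rewrite /Kexp big_cons.
split=> [|n]; first by rewrite IH1 KE addn0.
rewrite lvD !lvMn IH2 IH1 /= addn0 lvM lv_vartheta big_cons KE addKn.
congr (_ + _); rewrite -sumrMnl big_seq [RHS]big_seq; apply: eq_bigr => b sb.
by rewrite -mulrnA -expnD addnC addnBA ?Kexp_ge.
Qed.

Definition gexp c := Kexp c (arange p).

Lemma gammaK_exp c x y : (gammaK c x y).1 = gexp c.
Proof. by case: (gamma_fold c x y (arange p)). Qed.

Lemma lv_gammaK c x y n : lv (gammaK c x y).2 n = \sum_(a <- arange p)
    lv (c a).2 n * vth a (lv x n) (lv y n) *+ p ^ (gexp c - (c a).1).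
Proof. by case: (gamma_fold c x y (arange p)). Qed.

(** [Pin_div] provides a quotient, so the choice made by [epsilon] satisfies its specification;
    since [O] has no [p]-torsion, the chosen element is that quotient. *)
Lemma KtoO_spec j (g : Kelt p) : Kin j g ->
  Pin j (KtoO g) /\ forall n, lv (KtoO g) n *+ p ^ g.1 = lv g.2 n.
Proof.
move=> /(Pin_div Hp) [D hD eD].
have eDg : Onat (p ^ g.1) D = g.2 by apply: (lv_inj (Hp := Hp)) => n; rewrite lvMn eD.
have [hz ez] := epsilon_spec (inhabits (Ozero p))
  (fun z => isO z /\ Onat (p ^ g.1) z = g.2) (ex_intro _ D (conj (Pin_isO hD) eDg)).
have -> : KtoO g = D.
  apply: (isO_cancel (Hp := Hp) (k := g.1)) => //; first exact: (Pin_isO hD).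
  by move=> n; rewrite -!lvMn eDg -ez.
by split=> // n; rewrite eD.
Qed.

Section Bracket.
Variables (i : nat) (c : nat -> Kelt p).
Hypothesis gamma_Kin :
  forall x y, Pin i x -> Pin i y -> Kin (2 * i + 1) (gammaK c x y).

Lemma gamO_spec x y : Pin i x -> Pin i y ->
  Pin (2 * i + 1) (gamO c x y) /\
  forall n, lv (gamO c x y) n *+ p ^ gexp c = \sum_(a <- arange p)
    lv (c a).2 n * vth a (lv x n) (lv y n) *+ p ^ (gexp c - (c a).1).
Proof.
move=> hx hy; have [h1 h2] := KtoO_spec (gamma_Kin hx hy).
split; [exact: h1 | move=> n].
by rewrite -lv_gammaK -h2 gammaK_exp.
Qed.

Local Opaque gamO.

Lemma gamO_isO x y : Pin i x -> Pin i y -> isO (gamO c x y).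
Proof. move=> hx hy; have [h _] := gamO_spec hx hy. exact: Pin_isO h. Qed.

Lemma gamO_Pin x y : Pin i x -> Pin i y -> Pin i (gamO c x y).
Proof.
by move=> hx hy; have [h _] := gamO_spec hx hy; apply: (Pin_le Hp) h; lia.
Qed.

Lemma gamO_anti x y : Pin i x -> Pin i y -> gamO c y x = Oopp (gamO c x y).
Proof.
move=> hx hy; apply: (isO_cancel (Hp := Hp) (k := gexp c)).
- exact: gamO_isO.
- by apply: (isON Hp); apply: gamO_isO.
move=> n; rewrite lvN mulNrn.
have [_ e1] := gamO_spec hx hy; have [_ e2] := gamO_spec hy hx.
apply: etrans (e2 n) (etrans _ (congr1 -%R (esym (e1 n)))).
by rewrite -sumrN; apply: eq_bigr => a _; rewrite vth_anti mulrN mulNrn.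
Qed.

Lemma gamOBl x x' y : Pin i x -> Pin i x' -> Pin i y ->
  gamO c (Osub x x') y = Osub (gamO c x y) (gamO c x' y).
Proof.
move=> hx hx' hy; have hB := PinB Hp hx hx'.
apply: (isO_cancel (Hp := Hp) (k := gexp c)).
- exact: gamO_isO.
- by apply: (isOB Hp); apply: gamO_isO.
move=> n; rewrite lvB mulrnBl.
have [_ e1] := gamO_spec hx hy; have [_ e2] := gamO_spec hx' hy.
have [_ e3] := gamO_spec hB hy.
apply: etrans (e3 n) (etrans _ (congr2 (fun u v => u - v) (esym (e1 n)) (esym (e2 n)))).
by rewrite -sumrB; apply: eq_bigr => a _; rewrite lvB vthBl mulrBr mulrnBl.
Qed.

Variable m : nat.
Hypothesis p_gt2 : (2 < p)%N.
Hypothesis nil_class : class_le i m c p.-1.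

(* The term [p - 1 >= 2] of the lower central series contains [p^m], so that the
   class bound forces [p^m] to be an ideal. *)
Lemma gamO_ideal x y : Pin i x -> Pin m y -> Pin m (gamO c x y).
Proof.
move=> hx hy; apply: nil_class.
(* In this form [lcs] unfolds twice: the outer sum is the single bracket of [x] and [y], and [y]
   enters the term below through the empty sum, since that term is taken modulo [p^m]. *)
have -> : p.-1.+1 = (p - 3).+3 by lia.
exists [:: (x, y)]; split=> [q /=|].
  case=> // <-; split=> //; exists [::]; split=> //=.
  have -> : Osub y (Ozero p) = y by apply: (lv_inj (Hp := Hp)) => n; rewrite lvB lv0 subr0.
  exact: hy.
have -> : Osub (gamO c x y) (Osum [seq gamO c q.1 q.2 | q <- [:: (x, y)]]) = Ozero p.
  by apply: (lv_inj (Hp := Hp)) => n; rewrite lvB lvsum big_seq1 subrr lv0.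
exact: Pin0.
Qed.

Lemma gamO_congr x x' y y' : Pin i x -> Pin i x' -> Pin i y -> Pin i y' ->
  Pin m (Osub x x') -> Pin m (Osub y y') ->
  Pin m (Osub (gamO c x y) (gamO c x' y')).
Proof.
move=> hx hx' hy hy' hdx hdy.
(* Antisymmetry places both differences in the second argument, where [gamO_ideal] applies. *)
have -> : Osub (gamO c x y) (gamO c x' y') =
    Osub (gamO c x (Osub y y')) (gamO c y' (Osub x x')).
  rewrite (gamO_anti (PinB Hp hy hy') hx) (gamO_anti (PinB Hp hx hx') hy').
  rewrite !gamOBl // (gamO_anti hx hy) (gamO_anti hx hy').
  move: (gamO c x y) (gamO c x y') (gamO c x' y') => r s t.
  by apply: (lv_inj (Hp := Hp)) => n; rewrite !lvE; ring.
by apply: (PinB Hp); apply: gamO_ideal.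
Qed.

End Bracket.
End Gamma.

(** * Common denominators, and membership in lists *)

(** Here [b / p^k] and [b' / p^k'] play the parts of [c_a] and [sigma(c'_a)], [r] that of
    [rho_a(u)], [w] that of [u] and [v] that of a value of [vartheta_a]. The congruence for one [a]
    is multiplied by [w * v] and brought to the common denominators [p^K] and [p^K'] of the two
    brackets. *)
Lemma rescale_cong (R : comNzRingType) (w v b b' r d : R) p k k' K K' :
  (k <= K)%N -> (k' <= K')%N ->
  b' *+ p ^ k - r * b *+ p ^ k' = d *+ p ^ (k' + k) ->
  w * (b' * v) *+ p ^ (K' - k') *+ p ^ K - b * (w * r * v) *+ p ^ (K - k) *+ p ^ K' =
  w * v * d *+ p ^ (K' + K).
Proof.
move=> /subnK <- /subnK <-; rewrite !addnK; move: (K - k)%N (K' - k')%N => l l' E.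
rewrite !expnD in E *; move: (p ^ k)%N (p ^ k')%N (p ^ l)%N (p ^ l')%N E => q q' t t' E.
transitivity (w * v * (b' *+ q - r * b *+ q') *+ t *+ t'); first ring.
rewrite E; ring.
Qed.

Lemma In_cat (A : Type) (s t : seq A) z :
  List.In z (s ++ t) -> List.In z s \/ List.In z t.
Proof.
elim: s => [|x s IH] /= => [h|[->|/IH []]]; by [right | left; left | left; right | right].
Qed.

Lemma In_nseq (A : Type) n (x z : A) : List.In z (nseq n x) -> z = x.
Proof. by elim: n => //= n IH [->|/IH]. Qed.

Lemma In_dyn_word p (x y z : PO p) b : List.In z (dyn_word x y b) -> z = x \/ z = y.
Proof.
rewrite /dyn_word; elim: b => //= r b IH h.
case: (In_cat h) => [h'|]; last exact: IH.
by case: (In_cat h') => h''; [left | right]; exact: In_nseq h''.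
Qed.

Lemma In_map (A B : Type) (f : A -> B) s z :
  List.In z (map f s) -> exists2 x, List.In x s & z = f x.
Proof.
elim: s => //= x s IH [<-|/IH [t ht ->]]; first by exists x => //; left.
by exists t => //; right.
Qed.

(** * The isomorphism *)

Section Transport.
Variable p : nat.
Hypothesis Hp : prime p.
Local Notation lv := (lv Hp).

Lemma isO_vartheta a (x y : PO p) : isO x -> isO y -> isO (vartheta a x y).
Proof.
by move=> hx hy; apply: (isOB Hp); apply: (isOM Hp); apply: (isO_sig Hp).
Qed.

(** The point is uniformity: a single [D] in the ideal serves all levels [n]. *)
Lemma Pin_sum_multiple m N (s : seq nat) (F : forall n, nat -> cyc (zl p n) Hp) :
  (forall a, a \in s -> exists2 D, Pin m D & forall n, F n a = lv D n *+ N) ->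
  exists2 D, Pin m D & forall n, \sum_(a <- s) F n a = lv D n *+ N.
Proof.
elim: s => [|a s IH] h.
  by exists (Ozero p) => [|n]; [exact: Pin0 | rewrite big_nil lv0 mul0rn].
have [D1 h1 e1] := h a (mem_head _ _).
have [|D2 h2 e2] := IH; first by move=> b sb; apply: h; rewrite inE sb orbT.
exists (Oadd D1 D2) => [|n]; first exact: PinD.
by rewrite big_cons e1 e2 lvD mulrnDl.
Qed.

Variables (i m j j' : nat) (c c' : nat -> Kelt p) (u uinv : PO p).
Hypotheses (gamma_Kin : forall x y, Pin i x -> Pin i y -> Kin (2 * i + 1) (gammaK c x y))
  (gamma'_Kin : forall x y, Pin i x -> Pin i y -> Kin (2 * i + 1) (gammaK c' x y)).
Hypotheses (hu : isO u) (huinv : isO uinv) (uK : Omul u uinv = Oone p).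
Hypotheses (cj : coprime j p) (cj' : coprime j' p) (jj' : (j * j' = 1 %[mod p])%N).
Hypothesis cong : forall a, a \in arange p ->
  Kin m (Ksub (Ksig j (c' a)) (Kmul (KofO (rho a u uinv)) (c a))).

Definition phi (x : PO p) := Omul u (Osig j x).
Definition psi (x : PO p) := Osig j' (Omul uinv x).

Lemma lv_uK n : lv u n * lv uinv n = 1.
Proof. by rewrite -lvM uK lv1. Qed.

Lemma cyc_sigma_mod1 (R : comNzRingType) (k : nat) (x : cyc R Hp) :
  (k = 1 %[mod p])%N -> cyc_sigma k x = x.
Proof.
move=> e; rewrite -cyc_sigma_mod e cyc_sigma_mod; exact: cyc_sigma_id.
Qed.

Lemma phiK x : psi (phi x) = x.
Proof.
apply: (lv_inj (Hp := Hp)) => n; rewrite /psi /phi !lvE mulrA.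
rewrite [lv uinv n * _]mulrC lv_uK mul1r (cyc_sigma_comp _ _ cj') cyc_sigma_mod1 //.
by rewrite mulnC.
Qed.

Lemma psiK x : phi (psi x) = x.
Proof.
apply: (lv_inj (Hp := Hp)) => n; rewrite /psi /phi !lvE.
by rewrite (cyc_sigma_comp _ _ cj) cyc_sigma_mod1 // mulrA lv_uK mul1r.
Qed.

Lemma phi_Pin k x : Pin k x -> Pin k (phi x).
Proof. by move=> hx; apply: (PinM Hp) => //; apply: (Pin_sig Hp). Qed.

Lemma psi_Pin k x : Pin k x -> Pin k (psi x).
Proof. by move=> hx; apply: (Pin_sig Hp) => //; apply: (PinM Hp). Qed.

Lemma psiB x y : psi (Osub x y) = Osub (psi x) (psi y).
Proof.
apply: (lv_inj (Hp := Hp)) => n; rewrite /psi !lvE.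
by rewrite mulrBr cyc_sigmaD cyc_sigmaN.
Qed.

Lemma psi0 : psi (Ozero p) = Ozero p.
Proof. by apply: (lv_inj (Hp := Hp)) => n; rewrite /psi !lvE mulr0 cyc_sigma0. Qed.

Lemma psiD x y : psi (Oadd x y) = Oadd (psi x) (psi y).
Proof. by apply: (lv_inj (Hp := Hp)) => n; rewrite /psi !lvE mulrDr cyc_sigmaD. Qed.

Lemma psiMz z x : psi (Oint z x) = Oint z (psi x).
Proof.
apply: (lv_inj (Hp := Hp)) => n; rewrite /psi !lvE mulrzAr.
move: (lv uinv n * lv x n) => y.
by case: z => k; rewrite ?NegzE ?mulrNz ?cyc_sigmaN -?pmulrn cyc_sigmaMn.
Qed.

(** Semilinearity of [psi] for [sigma_j']; the exponent is reduced modulo [p] to agree with the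
    second components in [smul]. *)
Lemma psi_theta k x :
  psi (Omul (Opow (Otheta p) k) x) = Omul (Opow (Otheta p) ((j' * k) %% p)) (psi x).
Proof.
apply: (lv_inj (Hp := Hp)) => n; rewrite /psi !lvE.
rewrite [lv uinv n * (_ * _)]mulrCA [in LHS](cyc_sigmaM _ _ cj').
rewrite (cyc_sigmaX _ _ cj') cyc_sigma_theta // -exprM; congr (_ * _).
by rewrite [in LHS](divn_eq (j' * k) p) exprD mulnC exprM cyc_theta_p expr1n mul1r.
Qed.

(** The hypothesis [cong] with denominators cleared: [Ksub] has denominator exponent
    [(c' a).1 + (c a).1], and [Pin_div] removes exactly that power of [p]. *)
Lemma coef_cong a : a \in arange p -> exists2 D, Pin m D & forall n,
  cyc_sigma j (lv (c' a).2 n) *+ p ^ (c a).1 -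
  lv (rho a u uinv) n * lv (c a).2 n *+ p ^ (c' a).1 =
  lv D n *+ p ^ ((c' a).1 + (c a).1).
Proof.
move=> /cong; rewrite /Kin => /(Pin_div Hp) [D hD eD]; exists D => // n.
by move: (eD n); rewrite /= add0n lvD lvMn lvMn lvN lvM lvsig mulNrn.
Qed.

Lemma phi_gamO x y : Pin i x -> Pin i y ->
  Pin m (Osub (phi (gamO c' x y)) (gamO c (phi x) (phi y))).
Proof.
move=> hx hy.
have [_ e'] := gamO_spec Hp gamma'_Kin hx hy.
have [_ e] := gamO_spec Hp gamma_Kin (phi_Pin hx) (phi_Pin hy).
have iO' := gamO_isO Hp gamma'_Kin hx hy.
have iO := gamO_isO Hp gamma_Kin (phi_Pin hx) (phi_Pin hy).
move: (gamO c' x y) (gamO c (phi x) (phi y)) e' e iO' iO => g' g e' e iO' iO.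
pose vt n a := vth a (cyc_sigma j (lv x n)) (cyc_sigma j (lv y n)).
(* The summand at [a] is the contribution of [a] to the difference of the two brackets, multiplied
   by [p^(gexp c' + gexp c)]. *)
have [a sa|D hD eD] := @Pin_sum_multiple m (p ^ (gexp c' + gexp c)) (arange p)
  (fun n a =>
    lv u n * (cyc_sigma j (lv (c' a).2 n) * vt n a) *+ p ^ (gexp c' - (c' a).1) *+ p ^ gexp c -
    lv (c a).2 n * (lv u n * lv (rho a u uinv) n * vt n a)
      *+ p ^ (gexp c - (c a).1) *+ p ^ gexp c').
  have [D hD eD] := coef_cong sa.
  (* The summand is [u * vartheta_a(sigma x, sigma y)] times [sigma(c'_a) - rho_a(u) c_a], whose
     value in the ideal is the [D] of [coef_cong]. *)
  exists (Omul (Omul u (vartheta a (Osig j x) (Osig j y))) D).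
    apply: (PinM Hp) hD; apply: (isOM Hp) => //; apply: isO_vartheta.
      exact: (isO_sig Hp) (Pin_isO hx).
    exact: (isO_sig Hp) (Pin_isO hy).
  move=> n; move: (eD n); rewrite !lvM lv_vartheta !lvsig -/(vt n a).
  exact: rescale_cong (Kexp_ge c sa) (Kexp_ge c' sa).
suff -> : Osub (phi g') g = D by [].
apply: (isO_cancel (Hp := Hp) (k := (gexp c' + gexp c)%N)).
- apply: (isOB Hp) => //; apply: (isOM Hp) => //; exact: (isO_sig Hp).
- exact: Pin_isO hD.
move=> n; rewrite -eD sumrB lvB lvM lvsig expnD mulrnA !mulrnBl.
congr (_ - _).
  (* The first sum comes from [gamma'] by moving [sigma] inside [vartheta_a]; the second, below,
     from [gamma] by pulling [u] out with [vth_mul]. *)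
  rewrite -mulrnAr -cyc_sigmaMn e'.
  rewrite cyc_sigma_sum mulr_sumr -sumrMnl big_seq [RHS]big_seq; apply: eq_bigr => a sa.
  by rewrite cyc_sigmaMn (cyc_sigmaM _ _ cj) vth_sigma // -mulrnAr.
rewrite mulrnAC e -sumrMnl big_seq [RHS]big_seq; apply: eq_bigr => a sa.
by rewrite !lvM !lvsig (vth_mul _ _ sa (lv_uK n)).
Qed.

Hypothesis p_gt2 : (2 < p)%N.
Hypothesis nil_class : class_le i m c' p.-1.

(** Apply [phi_gamO] to [psi x] and [psi y], then [psi] to the difference, which stays in the ideal;
    the sign changes. *)
Lemma psi_gamO x y : Pin i x -> Pin i y ->
  Pin m (Osub (psi (gamO c x y)) (gamO c' (psi x) (psi y))).
Proof.
move=> hx hy; have := phi_gamO (psi_Pin hx) (psi_Pin hy).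
rewrite !psiK => /psi_Pin; rewrite psiB phiK => /(PinN Hp).
by congr Pin; apply: (lv_inj (Hp := Hp)) => n; rewrite lvN !lvB opprB.
Qed.

Lemma Pin_sub_trans k (x y z : PO p) :
  Pin k (Osub x y) -> Pin k (Osub y z) -> Pin k (Osub x z).
Proof.
move=> h1 h2; have := PinD Hp h1 h2; congr Pin.
by apply: (lv_inj (Hp := Hp)) => n; rewrite lvD !lvB addrA subrK.
Qed.

Lemma Pin_subxx k (x : PO p) : Pin k (Osub x x).
Proof.
have -> : Osub x x = Ozero p by apply: (lv_inj (Hp := Hp)) => n; rewrite lvB subrr.
exact: Pin0.
Qed.

Lemma nest_Pin d (s : seq (PO p)) :
  (forall x y, Pin i x -> Pin i y -> Kin (2 * i + 1) (gammaK d x y)) ->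
  (forall x, List.In x s -> Pin i x) -> Pin i (nest (gamO d) s).
Proof.
move=> hd; elim: s => [|x [|y s] IH] h; first exact: Pin0.
  by apply: h; left.
apply: (gamO_Pin Hp hd); first by apply: h; left.
by apply: IH => z hz; apply: h; right.
Qed.

(** As [psi] respects brackets only modulo [p^m], the error of the inner bracket has to survive the
    outer one. This is [gamO_congr] for [gamma'], where the class bound enters. *)
Lemma nest_psi (s : seq (PO p)) : (forall x, List.In x s -> Pin i x) ->
  Pin m (Osub (psi (nest (gamO c) s)) (nest (gamO c') (map psi s))).
Proof.
elim: s => [|x [|y s] IH] h; first by rewrite /= psi0; exact: Pin_subxx.
  exact: Pin_subxx.
have hx : Pin i x by apply: h; left.
have hs z : List.In z (y :: s) -> Pin i z by move=> hz; apply: h; right.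
have hn := nest_Pin gamma_Kin hs.
have hn' : Pin i (nest (gamO c') (map psi (y :: s))).
  apply: (nest_Pin gamma'_Kin) => z hz.
  have [t ht ->] := In_map hz.
  by apply: psi_Pin; apply: hs.
apply: (Pin_sub_trans (psi_gamO hx hn)).
apply: (gamO_congr Hp gamma'_Kin p_gt2 nil_class) => //; try exact: psi_Pin.
  exact: Pin_subxx.
exact: IH.
Qed.

Lemma psi_sum_congr (A : Type) (F F' : A -> PO p) (s : seq A) :
  (forall a, Pin m (Osub (psi (F a)) (F' a))) ->
  Pin m (Osub (psi (Osum (map F s))) (Osum (map F' s))).
Proof.
move=> h; elim: s => [|a s IH]; first by rewrite /= psi0; exact: Pin_subxx.
have := PinD Hp (h a) IH; congr Pin.
rewrite /= !Osum_cons psiD.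
move: (psi (F a)) (F' a) (psi (Osum (map F s))) (Osum (map F' s)) => r t w z.
by apply: (lv_inj (Hp := Hp)) => n; rewrite !(lvD, lvB); ring.
Qed.

(** The truncated series is an integral combination of iterated brackets, with coefficients that
    depend on [p], [m] and the block only. They are the same for [gamma] and [gamma'], and [psi] is
    additive. *)
Lemma lazmul_psi x y : Pin i x -> Pin i y ->
  Pin m (Osub (psi (lazmul m c x y)) (lazmul m c' (psi x) (psi y))).
Proof.
move=> hx hy; apply: psi_sum_congr => b; rewrite psiMz.
have -> : dyn_word (psi x) (psi y) b = map psi (dyn_word x y b).
  rewrite /dyn_word map_flatten -map_comp; congr flatten; apply: eq_map => r /=.
  by rewrite map_cat !map_nseq.
have hw z : List.In z (dyn_word x y b) -> Pin i z by move=> /In_dyn_word [] ->.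
have := PinMz Hp (dyn_coef p m b) (nest_psi hw); congr Pin.
move: (psi (nest _ _)) (nest _ (map psi _)) => r t.
by apply: (lv_inj (Hp := Hp)) => n; rewrite lvMz !lvB !lvMz mulrzBl.
Qed.

End Transport.

(** * The isomorphism of the semidirect products *)

Lemma mod_inverse p j : coprime j p -> (1 < p)%N -> (0 < j)%N ->
  exists2 j', coprime j' p & (j * j' = 1 %[mod p])%N.
Proof.
move=> cj p1 j0; case: (egcdnP p j0) => j' v e _.
have jj' : (j * j' = 1 %[mod p])%N.
  by rewrite mulnC e (eqP cj) modnMDl.
exists j' => //; have : coprime (j * j') p by rewrite -coprime_modl jj' coprime_modl coprime1n.
by rewrite coprimeMl => /andP [].
Qed.

Lemma S_iso_of_congruence (p i m j : nat) (c c' : nat -> Kelt p) (u uinv : PO p) :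
  prime p -> (2 < p)%N -> (0 < j < p)%N ->
  (forall x y, Pin i x -> Pin i y -> Kin (2 * i + 1) (gammaK c x y)) ->
  (forall x y, Pin i x -> Pin i y -> Kin (2 * i + 1) (gammaK c' x y)) ->
  class_le i m c' p.-1 ->
  isO u -> isO uinv -> Omul u uinv = Oone p ->
  (forall a, a \in arange p ->
     Kin m (Ksub (Ksig j (c' a)) (Kmul (KofO (rho a u uinv)) (c a)))) ->
  S_iso i m c c'.
Proof.
move=> Hp p2 /andP [j0 jp] gK gK' nil hu huinv uK cong.
have cj : coprime j p by rewrite coprime_sym prime_coprime // gtnNdvd.
have [j' cj' jj'] := mod_inverse cj (prime_gt1 Hp) j0.
have p0 := prime_gt0 Hp.
have psik := phiK Hp uK cj' jj'; have phik := psiK Hp uK cj jj'.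
have psiP := psi_Pin Hp huinv cj'; have phiP := phi_Pin Hp hu cj.
have psi_eq x y : Pin m (Osub (psi j' uinv x) (psi j' uinv y)) <-> Pin m (Osub x y).
  by rewrite -(psiB Hp); split=> [/phiP|/psiP] //; rewrite phik.
have jK k : (k < p)%N -> ((j * ((j' * k) %% p)) %% p)%N = k.
  by move=> kp; rewrite modnMmr mulnA -modnMml jj' modnMml mul1n modn_small.
have j'K k : (k < p)%N -> ((j' * ((j * k) %% p)) %% p)%N = k.
  by move=> kp; rewrite modnMmr mulnA [(j' * j)%N]mulnC -modnMml jj' modnMml mul1n modn_small.
(* The second component is the exponent of [sigma_j'(theta^k) = theta^(j'k)]. *)
exists (fun s => (psi j' uinv s.1, ((j' * s.2) %% p)%N)); split; [|split; [|split]].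
- by move=> [x k] [hx hk]; split; [exact: psiP | exact: ltn_pmod].
- move=> [x k] [y l] [/= hx hk] [/= hy hl]; split=> [] [/= h1 h2]; split=> /=.
  + exact/psi_eq.
  + by rewrite -(jK k hk) h2 jK.
  + exact/psi_eq.
  + by rewrite h2.
- move=> [y l] [/= hy hl]; exists (phi j u y, ((j * l) %% p)%N); split.
    by split; [exact: phiP | exact: ltn_pmod].
  by split=> /=; [rewrite psik; exact: (Pin_subxx Hp) | exact: j'K].
move=> [x k] [y l] [/= hx hk] [/= hy hl]; split=> /=.
  (* The action of [theta^(j'k)] on [psi y] is the image of that of [theta^k] on [y], so only the
     product of [x] and [theta^k y] in the Lazard group remains. *)
  rewrite -(psi_theta Hp uinv cj').
  apply: (lazmul_psi Hp gK gK' hu huinv uK cj cj' jj' cong p2 nil hx).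
  exact: (PinM Hp) (isOX Hp _ (isO_theta Hp)) hy.
by rewrite modnMmr mulnDr modnDm.
Qed.

Theorem theorem5p2 (p : nat) (Hp : prime p) (Hp5 : (5 <= p)%N) (i m : nat)
  (c c' : nat -> Kelt p)
  (Hc : forall a, (2 <= a <= p.-1./2)%N -> isK (c a))
  (Hc' : forall a, (2 <= a <= p.-1./2)%N -> isK (c' a))
  (HH : inHhat i c) (HH' : inHhat i c')
  (Hdef : Ldefined i m c) (Hdef' : Ldefined i m c')
  (Hcl : class_le i m c p.-1) (Hcl' : class_le i m c' p.-1) :
  (exists (u uinv : PO p) (j : nat),
      isO u /\ isO uinv /\ Omul u uinv = Oone p /\
      (0 < j < p)%N /\
      (forall a, (2 <= a <= p.-1./2)%N ->
         Kin m (Ksub (Ksig j (c' a)) (Kmul (KofO (rho a u uinv)) (c a))))) ->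
  S_iso i m c c'.
Proof.
move=> [u [uinv [j [hu [huinv [uK [hj cong]]]]]]].
apply: (S_iso_of_congruence Hp _ hj HH.1 HH'.1 Hcl' hu huinv uK).
  exact: ltn_trans Hp5.
by move=> a /arange_bounds; exact: cong.
Qed.
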